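(* Let $n$ be even, let $a,b\in\mathbb{Z}_n$ with $a\not\equiv 0,\,n/2\pmod n$, and let $S=\{r^a,\,r^{-a},\,r^{n/2},\,sr^b\}\subseteq D_{2n}$. Let $\Gamma=\mathrm{Cay}(D_{2n},S)$, $T=\{\pm a,\,n/2\}\subset\mathbb{Z}_n$, and $M_b=\{\{r^i,\,sr^{b-i}\}: i\in\mathbb{Z}_n\}$. Then $$E(\Gamma)=E_R\cup E_F\cup M_b,$$ where $E_R=\{\{r^i,r^{i+t}\}: i\in\mathbb{Z}_n,\ t\in T\}$ and $E_F=\{\{sr^i,sr^{i+t}\}: i\in\mathbb{Z}_n,\ t\in T\}$ are the copies of $E(\mathrm{Cay}(\mathbb{Z}_n,T))$ on the rotations and on the reflections respectively. In particular, $\Gamma$ is formed by two isomorphic circulant graphs (each isomorphic to $\mathrm{Cay}(\mathbb{Z}_n,T)$) connected by a single perfect matching $M_b$ between rotations and reflections.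
   Context: $D_{2n}=\langle r,s\mid r^n=e,\ s^2=e,\ srs=r^{-1}\rangle$ is the dihedral group of order $2n$; the rotations are $r^i$ and the reflections are $sr^i$, $i\in\mathbb{Z}_n$; exponents are taken modulo $n$. For a group $G$ and an inverse-closed subset $S\subseteq G\setminus\{e\}$, the undirected Cayley graph $\mathrm{Cay}(G,S)$ has vertex set $G$, with $g,h$ adjacent if and only if $g^{-1}h\in S$ (so the edges are the pairs $\{g,gx\}$ with $g\in G$, $x\in S$). A perfect matching between rotations and reflections is a set of pairs $\{x,y\}$, $x$ a rotation and $y$ a reflection, such that every element of $D_{2n}$ lies in exactly one pair. *)

(* Defs.v *)
From HB Require Import structures.
From mathcomp Require Import all_boot all_order all_algebra all_fingroup all_solvable.

Set Implicit Arguments.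
Unset Strict Implicit.
Unset Printing Implicit Defensive.

Import GroupScope.
Local Open Scope group_scope.

(* Undirected graphs on a subset of T, an edge being the set of its ends. *)
Record graph (T : finType) := Graph { verts : {set T}; edges : {set {set T}} }.

Definition isomorphic (T U : finType) (G : graph T) (H : graph U) : Prop :=
  exists f : T -> U,
    [/\ {in verts G &, injective f},
        f @: verts G = verts H
      & {in verts G &, forall x y,
          ([set x; y] \in edges G) = ([set f x; f y] \in edges H)}].

(* Meaningful when S is inverse-closed and does not contain 1.  For the
   additive group 'Z_n the connection condition g^-1 * h reads - g + h. *)
Definition Cay (gT : finGroupType) (S : {set gT}) : graph gT :=
  Graph [set: gT] [set [set g; h] | g in [set: gT], h in [set: gT] & g^-1 * h \in S].

Definition connection_set (gT : finGroupType) (S : {set gT}) : bool :=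
  (1 \notin S) && (S^-1 == S).

Definition perfect_matching (T : finType) (A B : {set T}) (M : {set {set T}}) :
    Prop :=
  (forall e, e \in M -> exists x y, [/\ x \in A, y \in B & e = [set x; y]])
  /\ (forall v, v \in A :|: B -> #|[set e in M | v \in e]| = 1%N).

(* G consists of its vertex-disjoint induced subgraphs G1 and G2, and the
   edges of G between G1 and G2 are exactly those of the perfect matching M. *)
Definition joined_by_matching (T : finType) (G G1 G2 : graph T)
    (M : {set {set T}}) : Prop :=
  [/\ verts G = verts G1 :|: verts G2 /\ [disjoint verts G1 & verts G2],
      [set e in edges G | e \subset verts G1] = edges G1,
      [set e in edges G | e \subset verts G2] = edges G2,
      [set e in edges G | ~~ (e \subset verts G1) & ~~ (e \subset verts G2)] = M
    & perfect_matching (verts G1) (verts G2) M].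

(* Since 'D_(2n) has order 2n, which is also the order of the group presented
   by < r, s | r^n, s^2, s r s = r^-1 >, a generating pair that satisfies these
   relations presents 'D_(2n). *)
Definition dihedral_generators (n : nat) (r s : 'D_(n.*2)) : Prop :=
  [/\ <<[set r; s]>> = [set: 'D_(n.*2)],
      r ^+ n = 1, s ^+ 2 = 1 & s * r * s = r^-1].

Section Dihedral.

(* 'Z_n is the ring of integers mod n only for n > 1. *)
Variables (n : nat) (gT : finGroupType) (r s : gT).

Definition rotation (i : 'Z_n) : gT := r ^+ i.
Definition reflection (i : 'Z_n) : gT := s * r ^+ i.

Definition rotation_set : {set gT} := [set rotation i | i : 'Z_n].
Definition reflection_set : {set gT} := [set reflection i | i : 'Z_n].

Definition n_half : 'Z_n := (n./2)%:R%R.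

Definition conn_S (a b : 'Z_n) : {set gT} :=
  [set rotation a; rotation (- a)%R; rotation n_half; reflection b].

Definition conn_T (a : 'Z_n) : {set 'Z_n} := [set a; (- a)%R; n_half].

Definition E_R (a : 'Z_n) : {set {set gT}} :=
  [set [set rotation i; rotation (i + t)%R] | i in [set: 'Z_n], t in conn_T a].

Definition E_F (a : 'Z_n) : {set {set gT}} :=
  [set [set reflection i; reflection (i + t)%R] | i in [set: 'Z_n], t in conn_T a].

Definition M_ (b : 'Z_n) : {set {set gT}} :=
  [set [set rotation i; reflection (b - i)%R] | i : 'Z_n].

End Dihedral.

Lemma dihedral_generators_exist n :
  1 < n -> exists r s : 'D_(n.*2), dihedral_generators r s.
Proof.
move=> n_gt1; have := Grp_dihedral n_gt1 'D_(n.*2); rewrite homg_refl => /esym.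
case/existsP=> -[r s] /= /eqP[gen rn s2 rs]; exists r, s; split=> //.
  by rewrite -[RHS]gen joing_idl joing_idr.
have sV: s^-1 = s by apply/eqP; rewrite eq_invg_mul -expg2 s2.
by rewrite -rs conjgE sV mulgA.
Qed.

Lemma order_dihedral_generators n (r s : 'D_(n.*2)) :
  1 < n -> dihedral_generators r s -> #[r] = n /\ s \notin <[r]>.
Proof.
move=> n_gt1 [gen rn s2 srs].
have sV: s^-1 = s by apply/eqP; rewrite eq_invg_mul -expg2 s2.
have nrs: <[s]> \subset 'N(<[r]>).
  by rewrite norms_cycle conjgE sV mulgA srs groupV cycle_id.
have oD: #|<[r]> * <[s]>| = n.*2.
  by rewrite -norm_joinEr // joing_idl joing_idr [_ <*> _]gen card_dihedral.
have rle: #[r] <= n by rewrite dvdn_leq ?order_dvdn ?rn // ltnW.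
have sle: #[s] <= 2 by rewrite dvdn_leq ?order_dvdn ?s2.
have le2: n.*2 <= #[r] * #[s] by rewrite /order mul_cardG oD leq_pmulr.
split.
  apply/eqP; rewrite eqn_leq rle -leq_double -(muln2 #[r]).
  by rewrite (leq_trans le2) // leq_mul2l sle orbT.
apply/negP=> sr; have: #|<[r]> * <[s]>| <= n.
  by rewrite mulGSid ?cycle_subG.
by rewrite oD -addnn -{3}[n]addn0 leq_add2l leqn0; case: (n) n_gt1.
Qed.

Lemma n_half_facts n : 1 < n -> ~~ odd n ->
  n_half n != 0%R /\ (- n_half n = n_half n)%R.
Proof.
move=> n_gt1 n_even; split.
  apply/eqP=> /(congr1 val) /=; rewrite val_Zp_nat // modn_small.
    by case: n n_gt1 n_even => [|[|]].
  by rewrite -divn2 ltn_Pdiv // ltnW.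
apply/eqP; rewrite eq_sym -GRing.addr_eq0 -GRing.natrD addnn halfK.
by rewrite (negPf n_even) subn0 pchar_Zp.
Qed.

Lemma connection_conn_T n (a : 'Z_n) :
  1 < n -> ~~ odd n -> a != 0%R -> connection_set (conn_T a).
Proof.
move=> n_gt1 n_even a0; have [h0 hV] := n_half_facts n_gt1 n_even.
apply/andP; split.
  rewrite !inE !negb_or eq_sym a0 eq_sym.
  by rewrite -[1]/(0%R : 'Z_n) GRing.oppr_eq0 a0 eq_sym.
apply/eqP/setP=> x; rewrite !inE -[x^-1]/(- x)%R GRing.eqr_oppLR GRing.eqr_opp.
by rewrite GRing.eqr_oppLR hV [(_ == - a)%R || _]orbC.
Qed.

Lemma connection_conn_S n (r s : 'D_(n.*2)) (a b : 'Z_n) :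
    1 < n -> ~~ odd n -> a != 0%R -> dihedral_generators r s ->
  connection_set (conn_S r s a b).
Proof.
move=> n_gt1 n_even a0 D; have [or s'r] := order_dihedral_generators n_gt1 D.
have [h0 hV] := n_half_facts n_gt1 n_even; have [_ rn s2 srs] := D.
have sV: s^-1 = s by apply/eqP; rewrite eq_invg_mul -expg2 s2.
have rot1 (i : 'Z_n) : (1 == rotation r i) = (i == 0%R).
  have lt_i: i < n by rewrite -[ltnRHS]Zp_cast.
  by rewrite eq_sym /rotation -order_dvdn or -val_eqE /= /dvdn modn_small.
have rotV (i : 'Z_n) : (rotation r i)^-1 = rotation r (- i)%R.
  apply/eqP; rewrite eq_invg_mul /rotation -expgD -order_dvdn or.
  have/eqP := congr1 val (GRing.subrr i).
  by rewrite /= [X in _ %% X]Zp_cast.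
have reflV : (reflection r s b)^-1 = reflection r s b.
  apply/eqP; rewrite eq_invg_mul /reflection mulgA.
  have -> : s * r ^+ b * s = (r ^+ b) ^ s by rewrite conjgE sV mulgA.
  by rewrite conjXg conjgE sV mulgA srs expgVn mulVg.
apply/andP; split.
  rewrite !inE !rot1 GRing.oppr_eq0 (negPf a0) (negPf h0) /=.
  apply: contra s'r => /eqP/esym/(canRL (mulgK _)) ->.
  by rewrite mul1g groupV mem_cycle.
apply/eqP/setP=> x; rewrite !inE !(can2_eq invgK invgK) reflV !rotV.
by rewrite GRing.opprK hV [(_ == rotation r (- a)%R) || _]orbC.
Qed.

(* Main.v *)
Require Import Defs.
From HB Require Import structures.
From mathcomp Require Import all_boot all_order all_algebra all_fingroup all_solvable.

Set Implicit Arguments.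
Unset Strict Implicit.
Unset Printing Implicit Defensive.

Import GroupScope.
Local Open Scope group_scope.

(** Write S as the union of rotation @: T and {s r^b}.  An edge of a Cayley
    graph is a pair {g, g x} with x in S, so the edges are sorted by the kind of
    g and the kind of x, and the multiplication table of the dihedral group
    settles each case.  Right multiplication by r^t shifts the exponent of
    rotations and of reflections alike,
      r^i r^t = r^(i+t)    and    (s r^i) r^t = s r^(i+t),
    so the x in rotation @: T give one copy of Cay(Z_n, T) on each side, whereas
      r^i (s r^b) = s r^(b-i)    and    (s r^i) (s r^b) = r^(b-i),
    so the generator s r^b gives exactly the pairs of M_b, each of them met
    twice, once from either end.

    The rest holds because i |-> r^i and i |-> s r^i are injective with images
    that partition the group.  Two injective copies of one graph are isomorphic
    ([isomorphic_imset]), pairing two disjoint injective families by their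
    index is a perfect matching ([perfect_matching_imset]), and edges inside the
    two sides cannot be confused with edges across ([joined_by_matchingI]). *)

(** * Finite graphs *)

Lemma imset_pair (T U : finType) (f : T -> U) (x y : T) :
  f @: [set x; y] = [set f x; f y].
Proof. by rewrite imsetU !imset_set1. Qed.

Lemma imset_typeE (I T : finType) (f : I -> T) :
  [set f i | i : I] = f @: [set: I].
Proof.
by apply/setP=> x; apply/imsetP/imsetP=> -[i _ ->]; exists i; rewrite ?inE.
Qed.

(** The map f i |-> g i is the isomorphism.  It has to be defined on all of U,
    and x0 serves as the preimage of the points outside the image of f. *)
Lemma isomorphic_imset (T U V : finType) (x0 : T) (f : T -> U) (g : T -> V)
    (E : {set {set T}}) :
  injective f -> injective g ->
  isomorphic (Graph (f @: [set: T]) [set f @: (e : {set T}) | e in E])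
             (Graph (g @: [set: T]) [set g @: (e : {set T}) | e in E]).
Proof.
move=> f_inj g_inj; pose finv u := odflt x0 [pick x | f x == u].
have fK : cancel f finv.
  move=> x; rewrite /finv; case: pickP => [y /eqP/f_inj //|/(_ x)].
  by rewrite eqxx.
exists (g \o finv); split=> /=.
- by move=> _ _ /imsetP[x _ ->] /imsetP[y _ ->] /=; rewrite !fK => /g_inj->.
- by rewrite -imset_comp; apply: eq_imset => x /=; rewrite fK.
move=> _ _ /imsetP[x _ ->] /imsetP[y _ ->] /=; rewrite !fK -!imset_pair.
by rewrite !mem_imset //; apply: imset_inj.
Qed.

(** Injectivity and disjointness together say that a vertex determines the
    index of the pair it lies in. *)
Lemma perfect_matching_imset (I T : finType) (f g : I -> T) :
  injective f -> injective g -> (forall i j, f i != g j) ->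
  perfect_matching (f @: [set: I]) (g @: [set: I]) [set [set f i; g i] | i : I].
Proof.
move=> f_inj g_inj fg; split=> [_ /imsetP[i _ ->]|v].
  by exists (f i), (g i); rewrite !imset_f.
have fgF i j : (f i == g j) = false by apply: negbTE.
have gfF i j : (g i == f j) = false by rewrite eq_sym.
have star i : (forall j, (v \in [set f j; g j]) = (j == i)) ->
    #|[set e in [set [set f j; g j] | j : I] | v \in e]| = 1%N.
  move=> vE; apply/eqP/cards1P; exists [set f i; g i]; apply/setP=> e.
  rewrite in_set in_set1; apply/andP/eqP=> [[/imsetP[j _ ->]]|->].
    by rewrite vE => /eqP->.
  by split; [apply/imsetP; exists i | rewrite vE].
case/setUP=> /imsetP[i _ vi]; apply: (star i) => j; rewrite vi in_set2.
  by rewrite fgF orbF (inj_eq f_inj) eq_sym.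
by rewrite gfF (inj_eq g_inj) eq_sym.
Qed.

(** Nonemptiness matters because a set of ends is only recognised as lying on
    one side by being a subset of it, and the empty set lies on both. *)
Lemma joined_by_matchingI (T : finType) (G G1 G2 : graph T) (M : {set {set T}}) :
    verts G = verts G1 :|: verts G2 -> [disjoint verts G1 & verts G2] ->
    edges G = edges G1 :|: edges G2 :|: M ->
    (forall e, e \in edges G1 -> e != set0 /\ e \subset verts G1) ->
    (forall e, e \in edges G2 -> e != set0 /\ e \subset verts G2) ->
    perfect_matching (verts G1) (verts G2) M ->
  joined_by_matching G G1 G2 M.
Proof.
move=> vG dis eG sub1 sub2 pM.
have nsub (e A B : {set T}) : e != set0 /\ e \subset A -> [disjoint A & B] ->
    (e \subset B) = false.
  case=> e0 eA dAB; apply: contraNF e0 => eB.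
  by rewrite -subset0 -(disjoint_setI0 dAB) subsetI eA.
have dis' : [disjoint verts G2 & verts G1] by rewrite disjoint_sym.
have side1 e : e \in edges G1 ->
    (e \subset verts G1) * ((e \subset verts G2) = false).
  by move=> /sub1 e1; split; [case: e1 | apply: nsub e1 dis].
have side2 e : e \in edges G2 ->
    (e \subset verts G2) * ((e \subset verts G1) = false).
  by move=> /sub2 e2; split; [case: e2 | apply: nsub e2 dis'].
have sideM e : e \in M ->
    ((e \subset verts G1) = false) * ((e \subset verts G2) = false).
  case/(proj1 pM)=> x [y [x1 y2 ->]]; rewrite !subUset !sub1set.
  by rewrite (disjointFr dis x1) (disjointFl dis y2) andbF.
split=> //; apply/setP=> e; rewrite inE eG !in_setU.
- apply/andP/idP=> [[/orP[/orP[]|] // eE]|eE]; last by rewrite eE side1.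
    by rewrite side2.
  by rewrite sideM.
- apply/andP/idP=> [[/orP[/orP[]|] // eE]|eE]; last by rewrite eE orbT side2.
    by rewrite side1.
  by rewrite sideM.
apply/and3P/idP=> [[/orP[/orP[]|] // eE]|eE]; last by rewrite eE orbT !sideM.
  by rewrite side1.
by rewrite !side2 //=.
Qed.

Lemma edges_CayE (gT : finGroupType) (S : {set gT}) :
  edges (Cay S) = [set [set g; g * x] | g in [set: gT], x in S].
Proof.
apply/setP=> e; apply/imset2P/imset2P=> [[g h _ ]|[g x _ xS ->]].
  by rewrite inE => /andP[_ ghS] ->; exists g (g^-1 * h); rewrite ?mulKVg.
by exists g (g * x); rewrite ?inE ?mulKg.
Qed.

(** * Multiplication of rotations and reflections *)

Section Relations.

Variables (n : nat) (gT : finGroupType) (r s : gT).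

(** The exponents of rotations are residues, so every rule below needs n > 1
    for 'Z_n to be the integers modulo n. *)
Lemma rotationD (i j : 'Z_n) : 1 < n -> r ^+ n = 1 ->
  rotation r i * rotation r j = rotation r (i + j)%R.
Proof.
move=> n_gt1 rn; rewrite /rotation -expgD -(expg_mod (i + j) rn) /=.
by rewrite [X in _ = r ^+ (_ %% X)]Zp_cast.
Qed.

Lemma reflectionD (i j : 'Z_n) : 1 < n -> r ^+ n = 1 ->
  reflection r s i * rotation r j = reflection r s (i + j)%R.
Proof. by move=> n_gt1 rn; rewrite -mulgA -[r ^+ i]/(rotation r i) rotationD. Qed.

(** From s r s = r^-1, moving s leftwards across r^i inverts it. *)
Lemma rotation_mul_reflection (i j : 'Z_n) :
    1 < n -> r ^+ n = 1 -> s ^+ 2 = 1 -> s * r * s = r^-1 ->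
  rotation r i * reflection r s j = reflection r s (j - i)%R.
Proof.
move=> n_gt1 rn s2 srs.
have sV : s^-1 = s by apply/eqP; rewrite eq_invg_mul -expg2 s2.
have srsX : s * rotation r i * s = (rotation r i)^-1.
  by rewrite -{1}sV -mulgA -conjgE conjXg conjgE sV mulgA srs expgVn.
have rV : (rotation r i)^-1 = rotation r (- i)%R.
  by apply/eqP; rewrite eq_invg_mul rotationD // GRing.subrr.
have rs : rotation r i * s = s * rotation r (- i)%R.
  by rewrite -rV -srsX !mulgA -expg2 s2 mul1g.
rewrite {1}/reflection mulgA rs -mulgA -[r ^+ j]/(rotation r j) rotationD //.
by rewrite GRing.addrC.
Qed.

Lemma reflectionM (i j : 'Z_n) :
    1 < n -> r ^+ n = 1 -> s ^+ 2 = 1 -> s * r * s = r^-1 ->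
  reflection r s i * reflection r s j = rotation r (j - i)%R.
Proof.
move=> n_gt1 rn s2 srs; rewrite {1}/reflection -mulgA -[r ^+ i]/(rotation r i).
by rewrite rotation_mul_reflection // mulgA -expg2 s2 mul1g.
Qed.

End Relations.

(** * Rotations and reflections partition the dihedral group *)

Section Partition.

Variables (n : nat) (r s : 'D_(n.*2)).

Lemma rotation_inj : 1 < n -> dihedral_generators r s ->
  injective (fun i : 'Z_n => rotation r i).
Proof.
move=> n_gt1 D i j /eqP; have [or _] := order_dihedral_generators n_gt1 D.
have lt_n (k : 'Z_n) : k < n by rewrite -[ltnRHS]Zp_cast.
rewrite /rotation eq_expg_mod_order or !modn_small //.
by move/eqP/val_inj.
Qed.

Lemma reflection_inj : 1 < n -> dihedral_generators r s ->
  injective (fun i : 'Z_n => reflection r s i).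
Proof. by move=> n_gt1 D i j /mulgI/(rotation_inj n_gt1 D). Qed.

Lemma rotation_neq_reflection (i j : 'Z_n) : 1 < n -> dihedral_generators r s ->
  rotation r i != reflection r s j.
Proof.
move=> n_gt1 D; have [_] := order_dihedral_generators n_gt1 D.
apply: contra => /eqP/esym/(canRL (mulgK _)) ->.
by rewrite groupM ?groupV ?mem_cycle.
Qed.

Lemma disjoint_rotation_reflection : 1 < n -> dihedral_generators r s ->
  [disjoint rotation_set n r & reflection_set n r s].
Proof.
move=> n_gt1 D; apply/pred0P=> x /=; apply/andP=> -[/imsetP[i _ ->]].
by case/imsetP=> j _ /eqP; apply/negP/rotation_neq_reflection.
Qed.

(** By counting: two disjoint sets of n elements fill a group of order 2n. *)
Lemma rotationU_reflection : 1 < n -> dihedral_generators r s ->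
  rotation_set n r :|: reflection_set n r s = [set: 'D_(n.*2)].
Proof.
move=> n_gt1 D; apply/eqP; rewrite eqEcard subsetT /= card_dihedral //.
rewrite cardsU disjoint_setI0 ?disjoint_rotation_reflection // cards0 subn0.
rewrite !card_imset; [|exact: reflection_inj|exact: rotation_inj].
by rewrite card_ord Zp_cast // addnn.
Qed.

Lemma dihedral_eltP (x : 'D_(n.*2)) : 1 < n -> dihedral_generators r s ->
  (exists i : 'Z_n, x = rotation r i) \/ (exists i : 'Z_n, x = reflection r s i).
Proof.
move=> n_gt1 D; have := in_setT x; rewrite -rotationU_reflection //.
by case/setUP=> /imsetP[i _ ->]; [left|right]; exists i.
Qed.

(** * The edges of the Cayley graph *)

Lemma edges_Cay_dihedral (a b : 'Z_n) : 1 < n -> dihedral_generators r s ->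
  edges (Cay (conn_S r s a b)) = E_R r a :|: E_F r s a :|: M_ r s b.
Proof.
move=> n_gt1 D; have [_ rn s2 srs] := D.
have -> : conn_S r s a b = rotation r @: conn_T a :|: [set reflection r s b].
  by rewrite /conn_S /conn_T !imsetU !imset_set1.
rewrite edges_CayE; apply/setP=> e; apply/imset2P/idP=> [[g x _ xS ->]|].
  case/setUP: xS => [/imsetP[t tT ->]|/set1P->];
    case: (dihedral_eltP g n_gt1 D) => -[i ->].
  - rewrite rotationD // !in_setU; apply/orP; left; apply/orP; left.
    by apply/imset2P; exists i t.
  - rewrite reflectionD // !in_setU; apply/orP; left; apply/orP; right.
    by apply/imset2P; exists i t.
  - rewrite rotation_mul_reflection // in_setU; apply/orP; right.
    by apply/imsetP; exists i.
  (* The pair of M_b met from its reflection s r^i has index b - i. *)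
  rewrite reflectionM // setUC in_setU; apply/orP; right.
  by apply/imsetP; exists (b - i)%R; rewrite ?GRing.subKr.
case/setUP=> [/setUP[]/imset2P[i t _ tT ->]|/imsetP[i _ ->]].
- by exists (rotation r i) (rotation r t); rewrite ?inE ?imset_f ?rotationD.
- exists (reflection r s i) (rotation r t);
    by rewrite ?inE ?imset_f ?reflectionD.
exists (rotation r i) (reflection r s b);
  by rewrite ?inE ?eqxx ?orbT ?rotation_mul_reflection.
Qed.

End Partition.

(** With f one of rotation r and reflection r s, the right-hand side is E_R or
    E_F by definition. *)
Lemma imset_edges_Cay (n : nat) (gT : finGroupType) (f : 'Z_n -> gT)
    (T : {set 'Z_n}) :
  [set f @: (e : {set 'Z_n}) | e in edges (Cay T)] =
  [set [set f i; f (i + t)%R] | i in [set: 'Z_n], t in T].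
Proof.
rewrite edges_CayE; apply/setP=> e; apply/imsetP/imset2P.
  by case=> _ /imset2P[i t _ tT ->] ->; exists i t; rewrite // imset_pair.
case=> i t _ tT ->; exists [set i; i + t]%R; rewrite ?imset_pair //.
by apply/imset2P; exists i t.
Qed.

Theorem proposition5p2 (n : nat) (n_gt1 : 1 < n) (n_even : ~~ odd n)
    (r s : 'D_(n.*2)) (Drs : dihedral_generators r s)
    (a b : 'Z_n) (a_neq0 : a != 0%R) (a_neq_half : a != n_half n) :
  let Gamma := Cay (conn_S r s a b) in
  let C := Cay (conn_T a) in
  let GR := Graph (rotation_set n r) (E_R r a) in
  let GF := Graph (reflection_set n r s) (E_F r s a) in
  [/\ edges Gamma = E_R r a :|: E_F r s a :|: M_ r s b,
      E_R r a = [set rotation r @: (e : {set 'Z_n}) | e in edges C],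
      E_F r s a = [set reflection r s @: (e : {set 'Z_n}) | e in edges C],
      [/\ isomorphic GR C, isomorphic GF C & isomorphic GR GF]
    & joined_by_matching Gamma GR GF (M_ r s b)].
Proof.
move=> Gamma C GR GF.
have eGamma : edges Gamma = E_R r a :|: E_F r s a :|: M_ r s b.
  exact: edges_Cay_dihedral.
have eR : E_R r a = [set rotation r @: (e : {set 'Z_n}) | e in edges C].
  by rewrite imset_edges_Cay.
have eF : E_F r s a = [set reflection r s @: (e : {set 'Z_n}) | e in edges C].
  by rewrite imset_edges_Cay.
have rI := rotation_inj n_gt1 Drs; have fI := reflection_inj n_gt1 Drs.
have copyR : GR = Graph (rotation r @: [set: 'Z_n])
    [set rotation r @: (e : {set 'Z_n}) | e in edges C].
  by rewrite -eR -imset_typeE.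
have copyF : GF = Graph (reflection r s @: [set: 'Z_n])
    [set reflection r s @: (e : {set 'Z_n}) | e in edges C].
  by rewrite -eF -imset_typeE.
have copyC : C = Graph (id @: [set: 'Z_n])
    [set id @: (e : {set 'Z_n}) | e in edges C].
  rewrite imset_id; congr Graph; rewrite -[LHS]imset_id.
  by apply: eq_imset => e; rewrite imset_id.
split=> //.
  split.
  - by rewrite copyR {2}copyC; apply: (isomorphic_imset 0%R).
  - by rewrite copyF {2}copyC; apply: (isomorphic_imset 0%R).
  by rewrite copyR copyF; apply: (isomorphic_imset 0%R).
apply: joined_by_matchingI => //=.
- by rewrite rotationU_reflection.
- exact: disjoint_rotation_reflection.
- move=> _ /imset2P[i t _ _ ->]; split; last by rewrite subUset !sub1set !imset_f.
  by apply/set0Pn; exists (rotation r i); rewrite set21.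
- move=> _ /imset2P[i t _ _ ->]; split; last by rewrite subUset !sub1set !imset_f.
  by apply/set0Pn; exists (reflection r s i); rewrite set21.
have bK : involutive (fun i : 'Z_n => b - i)%R by move=> i; apply: GRing.subKr.
rewrite /rotation_set imset_typeE.
(* Reindexing the reflections by i |-> b - i pairs equal indices. *)
have -> : reflection_set n r s =
    (fun i : 'Z_n => reflection r s (b - i)%R) @: [set: 'Z_n].
  apply/setP=> x; apply/imsetP/imsetP=> -[i _ ->]; last by exists (b - i)%R.
  by exists (b - i)%R; rewrite ?bK.
apply: perfect_matching_imset => // [i j /fI/(inv_inj bK) //|i j].
exact: rotation_neq_reflection.
Qed.
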